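(* The functor $\mathcal{P}_a^{oe}:\mathbf{SOp}\to\mathbf{ET}$ from symmetric operads to equational theories is faithful, full on isomorphisms (every isomorphism $\mathcal{P}_a^{oe}(\mathcal{O})\to\mathcal{P}_a^{oe}(\mathcal{O}')$ in $\mathbf{ET}$ is of the form $\mathcal{P}_a^{oe}(h)$ for an isomorphism $h$), and its essential image is the category $\mathbf{LrET}$ of linear-regular theories and linear-regular interpretations; i.e. it factorizes as an equivalence of categories $\mathcal{E}_o:\mathbf{SOp}\to\mathbf{LrET}$ followed by the inclusion $\mathbf{LrET}\to\mathbf{ET}$.
   Context: Symmetric operads. A symmetric operad $\mathcal{O}$ consists of sets $\mathcal{O}_n$ ($n\in\omega$), a unit $\iota\in\mathcal{O}_1$, compositions $\ast:\mathcal{O}_{n_1}\times\dots\times\mathcal{O}_{n_k}\times\mathcal{O}_k\to\mathcal{O}_n$ with $n=\sum_i n_i$, written $\langle f_1,\dots,f_k\rangle\ast f$, and left actions $\cdot:S_n\times\mathcal{O}_n\to\mathcal{O}_n$, such that composition is associative with unit $\iota$ and compatible with the actions: $\langle\sigma_1\cdot f_1,\dots,\sigma_k\cdot f_k\rangle\ast(\tau\cdot f)=(\langle\sigma_1,\dots,\sigma_k\rangle\star\tau)\cdot(\langle f_{\tau(1)},\dots,f_{\tau(k)}\rangle\ast f)$, where $\langle\sigma_1,\dots,\sigma_k\rangle\star\tau:\sum_i n_{\tau(i)}\to\sum_i n_i$ is $\langle i,r\rangle\mapsto\langle\tau(i),\sigma_{\tau(i)}(r)\rangle$ (lexicographic orders).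 Morphisms preserve arities, unit, compositions and actions. The category is $\mathbf{SOp}$. Equational theories. An equational theory is a pair $T=(L,A)$, where $L=\bigcup_n L_n$ ($L_n$ the set of $n$-ary function symbols, disjoint for different $n$) and $A$ is a set of equations in context $t=s:\vec{x}^n$, where $t,s$ are $L$-terms whose variables are among $\vec{x}^n=\langle x_1,\dots,x_n\rangle$. $A\vdash$ denotes provability in equational logic of equations in context. An interpretation $I:(L,A)\to(L',A')$ assigns to each $f\in L_n$ an $L'$-term $I(f):\vec{x}^n$ in such a way that the extension $\bar I$ to terms, $\bar I(x_i)=x_i$, $\bar I(f(t_1,\dots,t_k))=I(f)(x_1\backslash\bar I(t_1),\dots,x_k\backslash\bar I(t_k))$ (simultaneous substitution), satisfies $A'\vdash\bar I(t)=\bar I(s):\vec{x}^n$ for each $t=s:\vec{x}^n$ in $A$. Two interpretations $I,I'$ are identified if $A'\vdash I(f)=I'(f):\vec{x}^n$ for all $n$ and $f\in L_n$. This gives the category $\mathbf{ET}$. A term in context $t:\vec{x}^n$ is linear-regular if each of $x_1,\dots,x_n$ occurs in $t$ exactly once; an equation in context is linear-regular if both its sides are. A theory is linear-regular if every equation that is a consequence of it is a consequence of the set of its linear-regular consequences. An interpretation is linear-regular if it interprets function symbols as linear-regular terms. $\mathbf{LrET}$ is the subcategory of $\mathbf{ET}$ of linear-regular theories and linear-regular interpretations. The functor $\mathcal{P}_a^{oe}$. For a symmetric operad $\mathcal{O}$, $\mathcal{P}_a^{oe}(\mathcal{O})=(L,A)$ with $L_n=\mathcal{O}_n$ and $A$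 consisting of the equations: (1) $\iota(x_1)=x_1:\vec{x}^1$; (2) $f(f_1(x_1,\dots,x_{k_1}),\dots,f_m(x_{k_1+\dots+k_{m-1}+1},\dots,x_k))=(\langle f_1,\dots,f_m\rangle\ast f)(x_1,\dots,x_k):\vec{x}^k$ for $f\in\mathcal{O}_m$, $f_i\in\mathcal{O}_{k_i}$, $k=\sum_{i=1}^m k_i$; (3) $f(x_{\sigma(1)},\dots,x_{\sigma(n)})=(\sigma\cdot f)(x_1,\dots,x_n):\vec{x}^n$ for $f\in\mathcal{O}_n$, $\sigma\in S_n$. For a morphism $h:\mathcal{O}\to\mathcal{O}'$, $\mathcal{P}_a^{oe}(h)$ is the interpretation sending $f\in\mathcal{O}_n$ to $h(f)(x_1,\dots,x_n):\vec{x}^n$. *)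

(* Defs.v *)
From mathcomp Require Import all_boot all_order all_fingroup.
From Stdlib Require Import RelationClasses FunctionalExtensionality.

Set Implicit Arguments.
Unset Strict Implicit.
Unset Printing Implicit Defensive.

(** The arrows of a category form setoids: [eqv] is the equality of arrows, so
    that "interpretations are identified if ..." needs no quotient types. *)
Record category := Category {
  obj :> Type;
  hom : obj -> obj -> Type;
  eqv : forall a b, hom a b -> hom a b -> Prop;
  eqv_equiv : forall a b, Equivalence (@eqv a b);
  idc : forall a, hom a a;
  compc : forall a b c, hom b c -> hom a b -> hom a c;
  compc_eqv : forall a b c (g g' : hom b c) (f f' : hom a b),
    eqv g g' -> eqv f f' -> eqv (compc g f) (compc g' f');
  compcA : forall a b c d (h : hom c d) (g : hom b c) (f : hom a b),
    eqv (compc h (compc g f)) (compc (compc h g) f);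
  comp1c : forall a b (f : hom a b), eqv (compc (idc b) f) f;
  compc1 : forall a b (f : hom a b), eqv (compc f (idc a)) f
}.

Arguments hom {C} _ _ : rename.
Arguments eqv {C a b} _ _ : rename.
Arguments idc {C} _ : rename.
Arguments compc {C a b c} _ _ : rename.

Declare Scope cat_scope.
Delimit Scope cat_scope with cat.
Local Open Scope cat_scope.
Notation "f ~= g" := (eqv f g) (at level 70, no associativity) : cat_scope.
Notation "g \oc f" := (compc g f) (at level 40, left associativity) : cat_scope.

Lemma eqv_refl (C : category) (a b : C) (f : hom a b) : f ~= f.
Proof. by case: (eqv_equiv a b). Qed.

Lemma eqv_trans (C : category) (a b : C) (f g h : hom a b) :
  f ~= g -> g ~= h -> f ~= h.
Proof. by case: (eqv_equiv a b) => _ _; apply. Qed.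

Definition is_iso (C : category) (a b : C) (f : hom a b) : Prop :=
  exists g : hom b a, g \oc f ~= idc a /\ f \oc g ~= idc b.

Record functor (C D : category) := Functor {
  fobj :> C -> D;
  fmap : forall a b : C, hom a b -> hom (fobj a) (fobj b);
  fmap_eqv : forall a b (f g : hom a b), f ~= g -> fmap f ~= fmap g;
  fmap_id : forall a, fmap (idc a) ~= idc (fobj a);
  fmap_comp : forall a b c (g : hom b c) (f : hom a b),
    fmap (g \oc f) ~= fmap g \oc fmap f
}.

Arguments fmap {C D} f {a b} _ : rename.

Definition id_functor (C : category) : functor C C :=
  @Functor C C (fun a => a) (fun _ _ f => f) (fun _ _ _ _ e => e)
    (fun a => eqv_refl (idc a)) (fun _ _ _ g f => eqv_refl (g \oc f)).

Definition comp_functor (C D E : category) (G : functor D E) (F : functor C D) :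
  functor C E.
Proof.
refine (@Functor C E (fun a => G (F a)) (fun a b f => fmap G (fmap F f)) _ _ _).
- by move=> a b f g e; apply/fmap_eqv/fmap_eqv.
- by move=> a; apply: eqv_trans (fmap_id G _); apply/fmap_eqv/fmap_id.
- by move=> a b c g f; apply: eqv_trans (fmap_comp G _ _); apply/fmap_eqv/fmap_comp.
Defined.

(** Equality of arrows whose (co)domains are not convertible: it entails the
    equality of the domains and of the codomains, so that [functor_eq] below is
    strict equality on objects as well as on arrows. *)
Inductive heqv (C : category) (a b : C) (f : hom a b) :
  forall c d : C, hom c d -> Prop :=
| HEqv (g : hom a b) : f ~= g -> heqv f g.

Definition functor_eq (C D : category) (F G : functor C D) : Prop :=
  forall (a b : C) (f : hom a b), heqv (fmap F f) (fmap G f).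

Definition nat_iso (C D : category) (F G : functor C D) : Prop :=
  exists eta : forall a : C, hom (F a) (G a),
    (forall a, is_iso (eta a)) /\
    (forall a b (f : hom a b), eta b \oc fmap F f ~= fmap G f \oc eta a).

Definition is_equivalence (C D : category) (F : functor C D) : Prop :=
  exists G : functor D C,
    nat_iso (comp_functor G F) (id_functor C) /\
    nat_iso (comp_functor F G) (id_functor D).

Definition faithful (C D : category) (F : functor C D) : Prop :=
  forall (a b : C) (f g : hom a b), fmap F f ~= fmap F g -> f ~= g.

Definition full_on_isos (C D : category) (F : functor C D) : Prop :=
  forall (a b : C) (u : hom (F a) (F b)), is_iso u ->
    exists h : hom a b, is_iso h /\ fmap F h ~= u.

(** The subcategory given by a class [PO] of objects and a class [PH] of arrows.
    Its arrows are compared in the ambient category, hence they are the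
    [eqv]-classes having a member in [PH]. *)
Section Subcategory.
Variables (C : category) (PO : C -> Prop).
Variable PH : forall a b : C, hom a b -> Prop.
Hypothesis PH_id : forall a, PH (idc a).
Hypothesis PH_comp : forall a b c (g : hom b c) (f : hom a b),
  PH g -> PH f -> PH (g \oc f).

Definition subcategory : category.
Proof.
refine (@Category {a : C | PO a}
  (fun a b => {f : hom (proj1_sig a) (proj1_sig b) | PH f})
  (fun a b f g => proj1_sig f ~= proj1_sig g) _
  (fun a => exist _ (idc (proj1_sig a)) (PH_id _))
  (fun a b c g f => exist _ (proj1_sig g \oc proj1_sig f)
                      (PH_comp (proj2_sig g) (proj2_sig f))) _ _ _ _).
- move=> a b; have E := eqv_equiv (proj1_sig a) (proj1_sig b).
  split=> [f|f g|f g h]; [exact: reflexivity | exact: symmetry | exact: transitivity].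
- by move=> a b c g g' f f'; apply: compc_eqv.
- by move=> a b c d h g f; apply: compcA.
- by move=> a b f; apply: comp1c.
- by move=> a b f; apply: compc1.
Defined.

Definition subcategory_incl : functor subcategory C :=
  @Functor subcategory C (fun a => proj1_sig a) (fun _ _ f => proj1_sig f)
    (fun _ _ _ _ e => e) (fun _ => eqv_refl _) (fun _ _ _ _ _ => eqv_refl _).
End Subcategory.

(** Indices are numbered from 0: ['I_n] stands for {1, ..., n}.  The bijection
    between [{i : 'I_k & 'I_(n i)}], in lexicographic order, and
    ['I_(\sum_i n i)] is the [tagnat] of MathComp: [tagnat.Rank i r] is the
    position of [<i, r>], and [tagnat.sig1], [tagnat.sig2] are its components. *)
Section Star.
Variables (k : nat) (n : 'I_k -> nat) (s : forall i, 'S_(n i)) (t : 'S_k).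

Lemma sum_perm : \sum_(i < k) n (t i) = \sum_(i < k) n i.
Proof. exact/esym/reindex_inj/perm_inj. Qed.

Definition star_fun (j : 'I_(\sum_(i < k) n (t i))) : 'I_(\sum_(i < k) n i) :=
  let i := tagnat.sig1 j in tagnat.Rank (t i) (s (t i) (tagnat.sig2 j)).

Lemma star_fun_inj : injective star_fun.
Proof.
move=> j j' e; apply: tagnat.sig_inj; move: e; rewrite /star_fun /tagnat.sig1 /tagnat.sig2.
case: (tagnat.sig j) (tagnat.sig j') => [i r] [i' r'] /= /tagnat.rank_inj e.
have /perm_inj ei := congr1 tag e; rewrite -{i'}ei in r' e *.
by move: e => /eqP; rewrite eq_Tagged => /eqP/perm_inj ->.
Qed.

Lemma star_inj : injective (star_fun \o cast_ord (esym sum_perm)).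
Proof. exact/inj_comp/cast_ord_inj/star_fun_inj. Qed.

(** A bijection from [\sum_i n (t i)] to [\sum_i n i], seen as a permutation
    since the two numbers are equal. *)
Definition star : 'S_(\sum_(i < k) n i) := perm star_inj.
End Star.

(** [opcomp f h] is <f_1, ..., f_k> * h.  Elements of [op m] and [op n] with [m]
    and [n] propositionally equal are compared as elements of the disjoint union of all the [op n].  In MathComp
    [(s * t)%g x = t (s x)], whence the order of the factors in [actM]. *)
Record sym_operad := SymOperad {
  op :> nat -> Type;
  opunit : op 1;
  opcomp : forall k (n : 'I_k -> nat),
    (forall i, op (n i)) -> op k -> op (\sum_(i < k) n i);
  act : forall n, 'S_n -> op n -> op n;
  opcompA : forall k (n : 'I_k -> nat) (m : forall i, 'I_(n i) -> nat)
      (g : forall i j, op (m i j)) (f : forall i, op (n i)) (h : op k),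
    Tagged op (opcomp (fun i => opcomp (g i) (f i)) h) =
    Tagged op (opcomp (fun l => g (tagnat.sig1 l) (tagnat.sig2 l)) (opcomp f h));
  opcomp1l : forall k (f : op k),
    Tagged op (opcomp (fun _ : 'I_k => opunit) f) = Tagged op f;
  opcomp1r : forall m (f : op m),
    Tagged op (opcomp (fun _ : 'I_1 => f) opunit) = Tagged op f;
  act1 : forall n (f : op n), act 1%g f = f;
  actM : forall n (s t : 'S_n) (f : op n), act (t * s)%g f = act s (act t f);
  opcomp_act : forall k (n : 'I_k -> nat) (s : forall i, 'S_(n i)) (t : 'S_k)
      (f : forall i, op (n i)) (h : op k),
    opcomp (fun i => act (s i) (f i)) (act t h) =
    act (star s t)
      (ecast m (op m) (sum_perm n t) (opcomp (fun i => f (t i)) h))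
}.

Arguments opunit {O} : rename.
Arguments opcomp {O k n} _ _ : rename.
Arguments act {O n} _ _ : rename.

Record operad_hom (O O' : sym_operad) := OperadHom {
  ohom :> forall n, O n -> O' n;
  ohom_unit : ohom opunit = opunit;
  ohom_comp : forall k (n : 'I_k -> nat) (f : forall i, O (n i)) (h : O k),
    ohom (opcomp f h) = opcomp (fun i => ohom (f i)) (ohom h);
  ohom_act : forall n (s : 'S_n) (f : O n), ohom (act s f) = act s (ohom f)
}.

Arguments ohom {O O'} _ {n} _.

Definition operad_id (O : sym_operad) : operad_hom O O :=
  @OperadHom O O (fun _ f => f) erefl (fun _ _ _ _ => erefl) (fun _ _ _ => erefl).

Definition operad_comp (O1 O2 O3 : sym_operad)
  (h' : operad_hom O2 O3) (h : operad_hom O1 O2) : operad_hom O1 O3.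
Proof.
refine (@OperadHom O1 O3 (fun n f => ohom h' (ohom h f)) _ _ _).
- by rewrite !ohom_unit.
- by move=> k n f g; rewrite !ohom_comp.
- by move=> n s f; rewrite !ohom_act.
Defined.

Definition SOp : category.
Proof.
refine (@Category sym_operad operad_hom
  (fun O O' h h' => forall n (f : O n), ohom h f = ohom h' f) _
  operad_id operad_comp _ _ _ _) => //.
- move=> O O'; split=> [h n f //|h h' e n f|h1 h2 h3 e e' n f]; first by rewrite e.
  by rewrite e e'.
- by move=> O1 O2 O3 g g' f f' eg ef n x /=; rewrite ef eg.
Defined.

(** Terms in context: the variables of a [term L n] are among the [n] first. *)
Inductive term (L : nat -> Type) (n : nat) : Type :=
| Var of 'I_n
| App k (f : L k) (ts : 'I_k -> term L n).

Arguments Var {L n} _.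
Arguments App {L n k} f ts.

Section Terms.
Variable L : nat -> Type.

Fixpoint tsubst m n (s : 'I_m -> term L n) (t : term L m) : term L n :=
  match t with
  | Var i => s i
  | App k f ts => App f (fun i => tsubst s (ts i))
  end.

(** [gen_term f] is the term f(x_1, ..., x_n) in the context of n variables. *)
Definition gen_term n (f : L n) : term L n := App f Var.

Fixpoint occ n (i : 'I_n) (t : term L n) : nat :=
  match t with
  | Var j => (j == i)
  | App k f ts => \sum_(j < k) occ i (ts j)
  end.

Definition linreg n (t : term L n) : Prop := forall i, occ i t = 1.

Definition equations := forall n, term L n -> term L n -> Prop.

Inductive provable (A : equations) : equations :=
| prv_hyp n (t s : term L n) : A n t s -> provable A t s
| prv_refl n (t : term L n) : provable A t t
| prv_sym n (t s : term L n) : provable A t s -> provable A s t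
| prv_trans n (t s r : term L n) :
    provable A t s -> provable A s r -> provable A t r
| prv_app n k (f : L k) (ts ss : 'I_k -> term L n) :
    (forall i, provable A (ts i) (ss i)) -> provable A (App f ts) (App f ss)
| prv_subst m n (t s : term L m) (u : 'I_m -> term L n) :
    provable A t s -> provable A (tsubst u t) (tsubst u s).

Lemma tsubst_var n (t : term L n) : tsubst Var t = t.
Proof.
elim: t => //= k f ts IH; congr App; exact: functional_extensionality.
Qed.

Lemma tsubst_comp m n p (s : 'I_m -> term L n) (u : 'I_n -> term L p) t :
  tsubst u (tsubst s t) = tsubst (fun i => tsubst u (s i)) t.
Proof.
elim: t => //= k f ts IH; congr App; exact: functional_extensionality.
Qed.

Lemma prv_tsubst A m n (s s' : 'I_m -> term L n) (t : term L m) :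
  (forall i, provable A (s i) (s' i)) -> provable A (tsubst s t) (tsubst s' t).
Proof. by move=> e; elim: t => //= k f ts IH; apply: prv_app. Qed.

Lemma occ_tsubst m n (s : 'I_m -> term L n) (t : term L m) i :
  occ i (tsubst s t) = \sum_(j < m) occ j t * occ i (s j).
Proof.
elim: t => [j|k f ts IH] /=.
  rewrite (bigD1 j) //= eqxx mul1n big1 ?addn0 // => l.
  by rewrite eq_sym => /negbTE->.
rewrite (eq_bigr _ (fun j _ => IH j)) exchange_big /=.
by apply: eq_bigr => j _; rewrite big_distrl.
Qed.
End Terms.

Record eq_theory := EqTheory {
  symb : nat -> Type;
  eqns : equations symb
}.

Definition thm_of (T : eq_theory) : equations (symb T) := provable (@eqns T).
Arguments thm_of T {n} _ _.

Fixpoint ext_interp (L L' : nat -> Type) (I : forall n, L n -> term L' n)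
    n (t : term L n) : term L' n :=
  match t with
  | Var i => Var i
  | App k f ts => tsubst (fun i => ext_interp I (ts i)) (I k f)
  end.

Record interp (T T' : eq_theory) := Interp {
  isymb :> forall n, symb T n -> term (symb T') n;
  isymb_eqns : forall n (t s : term (symb T) n), eqns t s ->
    thm_of T' (ext_interp isymb t) (ext_interp isymb s)
}.

Arguments isymb {T T'} _ {n} _.

Lemma ext_interp_subst (L1 L2 : nat -> Type)
    (I : forall n, L1 n -> term L2 n) m n
    (s : 'I_m -> term L1 n) (t : term L1 m) :
  ext_interp I (tsubst s t) =
  tsubst (fun i => ext_interp I (s i)) (ext_interp I t).
Proof.
elim: t => //= k f ts IH; rewrite tsubst_comp; congr tsubst.
exact: functional_extensionality.
Qed.

Lemma ext_interp_id (L1 : nat -> Type) n (t : term L1 n) : ext_interp (@gen_term L1) t = t.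
Proof.
by elim: t => //= k f ts IH; congr App; apply: functional_extensionality.
Qed.

Lemma ext_interp_comp (L1 L2 L3 : nat -> Type)
    (I : forall n, L1 n -> term L2 n)
    (J : forall n, L2 n -> term L3 n) n (t : term L1 n) :
  ext_interp (fun n f => ext_interp J (I n f)) t = ext_interp J (ext_interp I t).
Proof.
elim: t => //= k f ts IH; rewrite ext_interp_subst; congr tsubst.
exact: functional_extensionality.
Qed.

Lemma ext_interp_thm (T T' : eq_theory) (I : interp T T') n
    (t s : term (symb T) n) :
  thm_of T t s -> thm_of T' (ext_interp I t) (ext_interp I s).
Proof.
rewrite /thm_of; elim=> {n t s} /=.
- by move=> n t s; apply: isymb_eqns.
- by move=> n t; apply: prv_refl.
- by move=> n t s _; apply: prv_sym.
- by move=> n t s r _ e _; apply: prv_trans.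
- by move=> n k f ts ss _ IH; apply: prv_tsubst.
- by move=> m n t s u _ IH; rewrite !ext_interp_subst; apply: prv_subst.
Qed.

Definition interp_id (T : eq_theory) : interp T T.
Proof.
refine (@Interp T T (@gen_term (symb T)) _).
by move=> n t s e; rewrite !ext_interp_id; apply: prv_hyp.
Defined.

Definition interp_comp (T1 T2 T3 : eq_theory)
  (J : interp T2 T3) (I : interp T1 T2) : interp T1 T3.
Proof.
refine (@Interp T1 T3 (fun n f => ext_interp J (isymb I f)) _).
by move=> n t s e; rewrite !ext_interp_comp; apply/ext_interp_thm/isymb_eqns.
Defined.

Definition interp_eqv (T T' : eq_theory) (I I' : interp T T') : Prop :=
  forall n (f : symb T n), thm_of T' (isymb I f) (isymb I' f).

Lemma ext_interp_eqv (T T' : eq_theory) (I I' : interp T T') n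
    (t : term (symb T) n) :
  interp_eqv I I' -> thm_of T' (ext_interp I t) (ext_interp I' t).
Proof.
move=> e; elim: t => [i|k f ts IH] /=; first exact: prv_refl.
apply: prv_trans (prv_subst _ (e k f)); exact: prv_tsubst.
Qed.

Definition ET : category.
Proof.
refine (@Category eq_theory interp interp_eqv _ interp_id interp_comp _ _ _ _).
- move=> T T'; split=> [I n f|I I' e n f|I1 I2 I3 e e' n f].
  + exact: prv_refl.
  + exact/prv_sym/e.
  + exact: prv_trans (e n f) (e' n f).
- move=> T1 T2 T3 J J' I I' eJ eI n f /=.
  by apply: prv_trans (ext_interp_eqv _ eJ); apply: ext_interp_thm; apply: eI.
- by move=> T1 T2 T3 T4 K J I n f /=; rewrite ext_interp_comp; apply: prv_refl.
- by move=> T1 T2 I n f /=; rewrite ext_interp_id; apply: prv_refl.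
- move=> T1 T2 I n f /=; rewrite tsubst_var; exact: prv_refl.
Defined.

Definition linreg_thms (T : eq_theory) : equations (symb T) :=
  fun n t s => [/\ thm_of T t s, linreg t & linreg s].

Definition linreg_theory (T : eq_theory) : Prop :=
  forall n (t s : term (symb T) n),
    thm_of T t s -> provable (@linreg_thms T) t s.

Definition linreg_interp (T T' : eq_theory) (I : interp T T') : Prop :=
  forall n (f : symb T n), linreg (isymb I f).

Lemma linreg_gen_term (L : nat -> Type) n (f : L n) : linreg (gen_term f).
Proof.
by move=> i; rewrite /= (bigD1 i) //= eqxx big1 // => j /negbTE->.
Qed.

Lemma occ_ext_interp (T T' : eq_theory) (I : interp T T') n
    (t : term (symb T) n) i :
  linreg_interp I -> occ i (ext_interp I t) = occ i t.
Proof.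
move=> lI; elim: t => //= k f ts IH; rewrite occ_tsubst.
by apply: eq_bigr => j _; rewrite lI mul1n.
Qed.

Lemma linreg_interp_id (T : eq_theory) : linreg_interp (interp_id T).
Proof. by move=> n f; apply: linreg_gen_term. Qed.

Lemma linreg_interp_comp (T1 T2 T3 : eq_theory)
    (J : interp T2 T3) (I : interp T1 T2) :
  linreg_interp J -> linreg_interp I -> linreg_interp (interp_comp J I).
Proof. by move=> lJ lI n f i; rewrite /= occ_ext_interp //; apply: lI. Qed.

Definition LrET : category :=
  @subcategory ET linreg_theory linreg_interp linreg_interp_id linreg_interp_comp.

Definition LrET_incl : functor LrET ET :=
  @subcategory_incl ET linreg_theory linreg_interp linreg_interp_id
    linreg_interp_comp.

Section TheoryOfOperad.
Variable O : sym_operad.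

Inductive operad_eqns : equations O :=
| oe_unit : operad_eqns (gen_term (opunit : O 1)) (Var ord0)
| oe_comp m (k : 'I_m -> nat) (fs : forall i, O (k i)) (f : O m) :
    operad_eqns (App f (fun i => App (fs i) (fun r => Var (tagnat.Rank i r))))
                (gen_term (opcomp fs f))
| oe_act n (s : 'S_n) (f : O n) :
    operad_eqns (App f (fun i => Var (s i))) (gen_term (act s f)).

Definition theory_of_operad : eq_theory := EqTheory operad_eqns.
End TheoryOfOperad.

Definition interp_of_operad_hom (O O' : sym_operad) (h : operad_hom O O') :
  interp (theory_of_operad O) (theory_of_operad O').
Proof.
refine (@Interp (theory_of_operad O) (theory_of_operad O')
  (fun n (f : O n) => gen_term (ohom h f)) _).
move=> n t s; case=> {n t s} /= *; apply: prv_hyp.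
- rewrite ohom_unit; exact: (oe_unit O').
- rewrite ohom_comp; exact: oe_comp.
- rewrite ohom_act; exact: oe_act.
Defined.

Definition Pa_oe : functor SOp ET.
Proof.
refine (@Functor SOp ET theory_of_operad interp_of_operad_hom _ _ _).
- by move=> O O' h h' e n f /=; rewrite e; apply: prv_refl.
- by move=> O n f; apply: prv_refl.
- by move=> O1 O2 O3 h' h n f; apply: prv_refl.
Defined.

(* Main.v *)
(** In the theory of an operad O every term is provably equal to some
    f(x_(v 0), ..., x_(v (m-1))) with f in O_m.  The pairs (f, v), up to the action
    of permutations, form a model, namely the free O-algebra, hence
    f(x_1, ..., x_n) = g(x_1, ..., x_n) is provable only if f = g: this is
    faithfulness.  Provable equality preserves the number of occurrences of each
    variable, so a linear-regular term is provably f(x_1, ..., x_n) for a unique f,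
    and a linear-regular interpretation between theories of operads comes from a
    unique morphism.  An isomorphism u is linear-regular: write
    u(f) = f'(x_v) and let b_j be the number of occurrences of x_j in u^-1(f').
    Since u^-1 u = 1, the sum of the b_j with v j = i is 1 for every i; since
    u u^-1 = 1, every b_j is positive; so v j = i for exactly one j.
    Finally a linear-regular theory T is isomorphic to the theory of the operad of
    its linear-regular terms modulo provable equality. *)

From mathcomp Require Import all_boot all_order all_fingroup.
From Stdlib Require Import FunctionalExtensionality PropExtensionality.
From Stdlib Require Import ProofIrrelevance ClassicalEpsilon Setoid Morphisms.
(* Last, since [act] of [Defs] shares its name with a projection of [fingroup]. *)
Require Import Defs.

Set Implicit Arguments.
Unset Strict Implicit.
Unset Printing Implicit Defensive.

(** * Lexicographic order *)

Section Lexicographic.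
Variables (k : nat) (n : 'I_k -> nat).

(** The type of the second component depends on the first, so both must be replaced at once: [W]
    packs them into a single argument. *)
Lemma sig_RankK A (w : forall i, 'I_(n i) -> A) i (r : 'I_(n i)) :
  w (tagnat.sig1 (tagnat.Rank i r)) (tagnat.sig2 (tagnat.Rank i r)) = w i r.
Proof.
pose W (p : {i & 'I_(n i)}) := w (tag p) (tagged p).
by rewrite -[LHS]/(W (tagnat.sig _)) tagnat.rankK.
Qed.

Lemma sum_sig (F : forall i, 'I_(n i) -> nat) :
  \sum_l F (tagnat.sig1 l) (tagnat.sig2 l) = \sum_i \sum_(j < n i) F i j.
Proof.
rewrite sig_big_dep /= (reindex _ (onW_bij _ tagnat.sig_bij)).
exact: eq_bigl.
Qed.

Lemma sum_eq_Rank l : \sum_i \sum_(r < n i) (tagnat.Rank i r == l) = 1.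
Proof.
rewrite -sum_sig (bigD1 l) //= tagnat.sig2K eqxx big1 // => j /negbTE.
by rewrite tagnat.sig2K => ->.
Qed.

(** Associativity of the lexicographic numbering. By [tagnat.RankEsum] a position is the total
    length of the preceding blocks plus an offset; the blocks before [l] are those with an earlier
    outer index, and those with the same outer index and an earlier inner one. *)
Lemma Rank_Rank (m : forall i, 'I_(n i) -> nat) l
    (r : 'I_(m (tagnat.sig1 l) (tagnat.sig2 l))) :
  tagnat.Rank (p_ := fun i => \sum_(j < n i) m i j) (tagnat.sig1 l)
    (tagnat.Rank (p_ := m (tagnat.sig1 l)) (tagnat.sig2 l) r) =
  tagnat.Rank (p_ := fun l => m (tagnat.sig1 l) (tagnat.sig2 l)) l r :> nat.
Proof.
rewrite !tagnat.RankEsum addnA; congr (_ + r).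
pose lt i (j : 'I_(n i)) := (tagnat.Rank i j < l)%N.
transitivity (\sum_i \sum_(j < n i | lt i j) m i j); last first.
  rewrite [RHS]big_mkcond /= (eq_bigr (fun l' => (fun i j => if lt i j then m i j else 0)
    (tagnat.sig1 l') (tagnat.sig2 l'))) => [|l' _]; last by rewrite /lt tagnat.sig2K.
  rewrite (sum_sig (fun i j => if lt i j then m i j else 0)).
  by apply: eq_bigr => i _; rewrite big_mkcond.
(* Since [tagnat.sig1] is monotone, the outer indices settle the comparison unless they are
   equal. *)
have ltE i j : lt i j = (i < tagnat.sig1 l)%N ||
    (i == tagnat.sig1 l) && (tagnat.Rank i j < l)%N.
  rewrite /lt; case: (ltngtP i (tagnat.sig1 l)) => [il|li|il]; last 1 first.
    by rewrite (introT eqP (val_inj il)).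
  - rewrite ltnNge; apply/negP => le.
    have : (tagnat.sig1 l <= tagnat.sig1 (tagnat.Rank i j))%N.
      exact: (@tagnat.le_sig1 _ n _ _ le).
    by rewrite tagnat.Rank1K leqNgt il.
  - have /negbTE-> /= : i != tagnat.sig1 l by apply: contraTneq li => ->; rewrite ltnn.
    apply/negbTE/negP => /ltnW le.
    have : (tagnat.sig1 (tagnat.Rank i j) <= tagnat.sig1 l)%N.
      exact: (@tagnat.le_sig1 _ n (tagnat.Rank i j) l le).
    by rewrite tagnat.Rank1K leqNgt li.
rewrite [RHS](bigID (fun i : 'I_k => (i < tagnat.sig1 l)%N)) /=; congr (_ + _).
  by apply: eq_bigr => i il; apply: eq_bigl => j; rewrite ltE il.
rewrite [RHS](bigD1 (tagnat.sig1 l)) /= ?ltnn //.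
rewrite [X in _ + X]big1 ?addn0 => [|i /andP[il ne]].
  apply: eq_bigl => j; rewrite /lt -[X in _ = (_ < nat_of_ord X)%N](@tagnat.sig2K _ n l).
  by rewrite !tagnat.RankEsum ltn_add2l.
by rewrite big1 // => j; rewrite ltE (negbTE il) (negbTE ne).
Qed.
End Lexicographic.

Lemma Rank_ones k (i : 'I_k) (r : 'I_1) :
  tagnat.Rank (p_ := fun _ => 1) i r = i :> nat.
Proof.
rewrite tagnat.RankEsum (ord1 r) addn0.
by rewrite -(big_ord_widen _ (fun=> 1) (ltnW (ltn_ord i))) sum1_card card_ord.
Qed.

(** * The free algebras of an operad *)

Lemma Tagged_ecast (T : nat -> Type) m n (x : T m) (y : T n) :
  Tagged T x = Tagged T y -> exists e : m = n, ecast p (T p) e x = y.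
Proof.
have tagE (p q : {n & T n}) :
    p = q -> exists e : tag p = tag q, ecast p (T p) e (tagged p) = tagged q.
  by move=> <-; exists erefl.
exact: tagE.
Qed.

Lemma star_Rank k (n : 'I_k -> nat) (s : forall i, 'S_(n i)) (t : 'S_k)
    (l : 'I_(\sum_i n (t i))) :
  star s t (cast_ord (sum_perm n t) l) =
  tagnat.Rank (t (tagnat.sig1 l)) (s (t (tagnat.sig1 l)) (tagnat.sig2 l)).
Proof. by rewrite permE /= cast_ordK. Qed.

Section NormalForms.
Variables (O : sym_operad) (N : nat).

(** [Nf f v] stands for the term f(x_(v 0), ..., x_(v (m-1))); modulo [nfeq]
    these are the elements of the free algebra on N generators. *)
Record nf := Nf {
  nf_ar : nat;
  nf_op : O nf_ar;
  nf_var : 'I_nf_ar -> 'I_N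
}.

Arguments nf_var : clear implicits.

(** The orbit relation given by the equations [oe_act]. The arities are only propositionally equal,
    hence the transport along [e]. *)
Definition nfeq (a b : nf) : Prop :=
  exists (e : nf_ar a = nf_ar b) (s : 'S_(nf_ar b)),
    act s (ecast m (O m) e (nf_op a)) = nf_op b /\
    forall i, nf_var b (s (cast_ord e i)) = nf_var a i.

Lemma nfeq_refl a : nfeq a a.
Proof.
exists erefl, 1%g; split=> [|i]; first exact: act1.
by rewrite perm1 cast_ord_id.
Qed.

Lemma nfeq_sym a b : nfeq a b -> nfeq b a.
Proof.
case: a b => [m f v] [m' g w] [/= e]; case: m' / e g w => g w [s [<- wE]].
exists erefl, s^-1%g; split=> [|i] /=; first by rewrite -actM mulgV act1.
by rewrite -wE /= !cast_ord_id permKV.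
Qed.

Lemma nfeq_trans a b c : nfeq a b -> nfeq b c -> nfeq a c.
Proof.
case: a b c => [m f v] [m1 g w] [m2 h u] [/= e1].
case: m1 / e1 g w => g w [s [<- wE]] [/= e2].
case: m2 / e2 h u => h u [t [<- uE]].
exists erefl, (s * t)%g; split=> [|i] /=; first exact: actM.
by have := uE (s i); rewrite permM /= !cast_ord_id => ->; rewrite -wE /= cast_ord_id.
Qed.

(** Serves the operad laws that hold only in the disjoint union of the arities: once these are
    identified, the permutation is 1. *)
Lemma nfeq_Tagged a b :
  Tagged O (nf_op a) = Tagged O (nf_op b) ->
  (forall (i : 'I_(nf_ar a)) (j : 'I_(nf_ar b)),
    i = j :> nat -> nf_var a i = nf_var b j) ->
  nfeq a b.
Proof.
case: a b => [m f v] [m' g w] /= /(@Tagged_ecast O _ _ _ _)[e <-] vw.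
exists e, 1%g; split=> [|i] /=; first exact: act1.
by rewrite perm1; apply/esym/vw.
Qed.

Definition nf_comp k (n : 'I_k -> nat) (f : forall i, O (n i))
    (v : forall i, 'I_(n i) -> 'I_N) (h : O k) : nf :=
  Nf (opcomp f h) (fun l => v (tagnat.sig1 l) (tagnat.sig2 l)).

Definition nf_app k (h : O k) (a : 'I_k -> nf) : nf :=
  nf_comp (fun i => nf_op (a i)) (fun i => nf_var (a i)) h.

(** This is [opcomp_act] with [star s t] as the witness. The case of trivial [s] gives [nf_app_act],
    that of trivial [t] gives [nf_app_nfeq]. *)
Lemma nf_comp_act k (n : 'I_k -> nat) (f : forall i, O (n i))
    (v w : forall i, 'I_(n i) -> 'I_N) (h : O k) (s : forall i, 'S_(n i)) (t : 'S_k) :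
  (forall i r, w i (s i r) = v i r) ->
  nfeq (nf_comp (fun i => f (t i)) (fun i => v (t i)) h)
       (nf_comp (fun i => act (s i) (f i)) w (act t h)).
Proof.
move=> wv; exists (sum_perm n t), (star s t); split=> /= [|l].
  exact/esym/opcomp_act.
by rewrite star_Rank (sig_RankK w) wv.
Qed.

Lemma nf_app_act k (h : O k) (t : 'S_k) (a : 'I_k -> nf) :
  nfeq (nf_app h (fun i => a (t i))) (nf_app (act t h) a).
Proof.
have := @nf_comp_act k _ (fun i => nf_op (a i)) (fun i => nf_var (a i))
  (fun i => nf_var (a i)) h (fun _ => 1%g) t (fun i r => congr1 _ (perm1 r)).
congr nfeq; congr nf_comp.
by apply: functional_extensionality_dep => i; rewrite act1.
Qed.

Lemma nf_app_nfeq k (h : O k) (a b : 'I_k -> nf) :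
  (forall i, nfeq (a i) (b i)) -> nfeq (nf_app h a) (nf_app h b).
Proof.
(* The arities are projections of [a i] and [b i], so the equality of the two arity families cannot
   be eliminated directly; the components are first turned into independent variables. *)
rewrite /nf_app; pose n i := nf_ar (a i); pose n' i := nf_ar (b i).
pose f i : O (n i) := nf_op (a i); pose f' i : O (n' i) := nf_op (b i).
pose v i : 'I_(n i) -> 'I_N := nf_var (a i).
pose v' i : 'I_(n' i) -> 'I_N := nf_var (b i).
have abE i : nfeq (Nf (f i) (v i)) (Nf (f' i) (v' i)) ->
    exists (e : n i = n' i) (s : 'S_(n' i)),
      act s (ecast m (O m) e (f i)) = f' i /\
      forall r, v' i (s (cast_ord e r)) = v i r by [].
move=> ab; change (nfeq (nf_comp f v h) (nf_comp f' v' h)).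
have {ab abE} ab i := abE i (ab i).
clearbody f f' v v'; clearbody n n'; clear a b.
have nn' : n = n' by apply: functional_extensionality => i; case: (ab i).
case: n' / nn' f' v' ab => f' v' ab.
have {ab} /fin_all_exists[s ab] i : exists s : 'S_(n i),
    act s (f i) = f' i /\ forall r, v' i (s r) = v i r.
  have [e [s [<- sE]]] := ab i; exists s; rewrite (eq_irrelevance e erefl).
  by split=> // r; rewrite -sE cast_ord_id.
have ff' : (fun i => act (s i) (f i)) = f'.
  by apply: functional_extensionality_dep => i; case: (ab i).
have := @nf_comp_act k n f v v' h s 1%g (fun i => (ab i).2).
rewrite ff' act1; apply: nfeq_trans.
(* What remains has [f (1 i)] for [f i], in the types as well; it is removed by generalizing the
   function underlying the permutation 1. *)
have := functional_extensionality _ _ (@perm1 'I_k).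
move: (_ (1 : 'S_k)%g) => t ->; exact: nfeq_refl.
Qed.

Lemma nf_app_unit (a : 'I_1 -> nf) : nfeq (nf_app opunit a) (a ord0).
Proof.
have -> : a = (fun _ => a ord0).
  by apply: functional_extensionality => i; rewrite (ord1 i).
case: (a ord0) => m f v; apply: nfeq_Tagged => /=; first exact: opcomp1r.
move=> l j lj /=; have -> : l = tagnat.Rank (p_ := fun=> m) ord0 j.
  by apply: ord_inj; rewrite lj tagnat.RankEsum big_pred0 // => i; rewrite (ord1 i).
exact: (sig_RankK (fun _ : 'I_1 => v)).
Qed.

Lemma nf_app_comp k (n : 'I_k -> nat) (fs : forall i, O (n i)) (f : O k)
    (a : 'I_(\sum_i n i) -> nf) :
  nfeq (nf_app f (fun i => nf_app (fs i) (fun r => a (tagnat.Rank i r))))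
       (nf_app (opcomp fs f) a).
Proof.
(* [opcompA] expects a family with two indices, so [a] is reindexed by pairs. *)
pose b i j := a (tagnat.Rank i j).
have -> : nf_app (opcomp fs f) a =
    nf_app (opcomp fs f) (fun l => b (tagnat.sig1 l) (tagnat.sig2 l)).
  by congr nf_app; apply: functional_extensionality => l; rewrite /b tagnat.sig2K.
apply: nfeq_Tagged.
  exact: (opcompA (fun i j => nf_op (b i j)) fs f).
move=> l l' ll' /=.
set i := tagnat.sig1 (tagnat.sig1 l'); set j := tagnat.sig2 (tagnat.sig1 l').
have -> : l = tagnat.Rank (p_ := fun i => \sum_j nf_ar (b i j)) i
    (tagnat.Rank (p_ := fun j => nf_ar (b i j)) j (tagnat.sig2 l')).
  apply: ord_inj; rewrite ll' (Rank_Rank (m := fun i j => nf_ar (b i j))).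
  by rewrite tagnat.sig2K.
rewrite (sig_RankK (fun i (r : 'I_(\sum_j nf_ar (b i j))) =>
  nf_var (b i (tagnat.sig1 r)) (tagnat.sig2 r))).
by rewrite (sig_RankK (fun j (r : 'I_(nf_ar (b i j))) => nf_var _ r)).
Qed.

Fixpoint nf_eval n (rho : 'I_n -> nf) (t : term O n) : nf :=
  match t with
  | Var i => rho i
  | App k f ts => nf_app f (fun i => nf_eval rho (ts i))
  end.

Lemma nf_eval_subst m n (rho : 'I_n -> nf) (u : 'I_m -> term O n) t :
  nf_eval rho (tsubst u t) = nf_eval (fun i => nf_eval rho (u i)) t.
Proof.
elim: t => //= k f ts IH; congr nf_app; exact: functional_extensionality.
Qed.

Lemma nf_eval_sound n (t s : term O n) (rho : 'I_n -> nf) :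
  thm_of (theory_of_operad O) t s -> nfeq (nf_eval rho t) (nf_eval rho s).
Proof.
rewrite /thm_of => ts; elim: ts rho => {n t s} /=.
- move=> n t s; case=> {n t s} /= [rho|m k fs f rho|n s f rho].
  + exact: nf_app_unit.
  + exact: nf_app_comp.
  + exact: nf_app_act.
- by move=> n t rho; apply: nfeq_refl.
- by move=> n t s _ IH rho; apply: nfeq_sym.
- by move=> n t s r _ IH _ IH' rho; apply: nfeq_trans (IH' rho).
- by move=> n k f ts ss _ IH rho; apply: nf_app_nfeq => i; apply: IH.
- by move=> m n t s u _ IH rho; rewrite !nf_eval_subst.
Qed.
End NormalForms.

Lemma gen_term_inj (O : sym_operad) n (f g : O n) :
  thm_of (theory_of_operad O) (gen_term f) (gen_term g) -> f = g.
Proof.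
(* The generic assignment: x_i goes to the i-th generator, so that [gen_term h] evaluates to h
   composed with units. *)
pose rho i := @Nf O n 1 opunit (fun _ => i).
have genE (h : O n) : nfeq (nf_eval rho (gen_term h)) (Nf h id).
  apply: nfeq_Tagged; first exact: opcomp1l.
  move=> l j lj /=; apply: ord_inj; rewrite -lj -[in RHS](tagnat.sig2K l).
  by rewrite Rank_ones.
move=> /(nf_eval_sound rho) fg.
have [e [s [/= <- sE]]] := nfeq_trans (nfeq_trans (nfeq_sym (genE f)) fg) (genE g).
(* Both sides carry the identity as variable map, so by [sE] the permutation fixes every index. *)
rewrite (eq_irrelevance e erefl) /=; have -> : s = 1%g; last by rewrite act1.
by apply/permP => i; rewrite perm1 -[RHS](sE i); congr (s _); apply: val_inj.
Qed.

(** * Linear-regular terms *)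

Lemma fibers1_bij m n (v : 'I_m -> 'I_n) :
  (forall i, \sum_j (v j == i) = 1) -> bijective v.
Proof.
move=> v1; have v_inj : injective v.
  move=> j j' e; apply/eqP/negP => /negP ne; have := v1 (v j).
  by rewrite (bigD1 j) //= eqxx (bigD1 j') 1?eq_sym //= -e eqxx.
have /fin_all_exists[w wK] i : exists j, v j = i.
  have [j _ /eqP] : exists2 j, true & v j == i.
    apply/exists_inP; apply: contraPT (v1 i) => /exists_inPn v0.
    by rewrite big1 // => j _; rewrite (negbTE (v0 j _)).
  by exists j.
by exists w => // j; apply: v_inj.
Qed.

Lemma bij_fibers1 m n (v : 'I_m -> 'I_n) i : bijective v -> \sum_j (v j == i) = 1.
Proof.
case=> w vK wK; rewrite (bigD1 (w i)) //= wK eqxx big1 // => j /negbTE ne.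
by rewrite -(can2_eq vK wK) in ne; rewrite ne.
Qed.

(** * Renaming, occurrences and grafting of terms *)

Section Renaming.
Variable L : nat -> Type.

Definition rename m n (v : 'I_m -> 'I_n) : term L m -> term L n :=
  tsubst (fun i => Var (v i)).

Lemma rename_id n (v : 'I_n -> 'I_n) t : v =1 id -> rename v t = t.
Proof.
move=> /functional_extensionality->; exact: tsubst_var.
Qed.

Lemma tsubst_rename m n p (v : 'I_m -> 'I_n) (s : 'I_n -> term L p) t :
  tsubst s (rename v t) = tsubst (fun i => s (v i)) t.
Proof. exact: tsubst_comp. Qed.

Lemma rename_rename m n p (v : 'I_n -> 'I_p) (w : 'I_m -> 'I_n) (t : term L m) :
  rename v (rename w t) = rename (fun i => v (w i)) t.
Proof. exact: tsubst_rename. Qed.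

Lemma eq_rename m n (v w : 'I_m -> 'I_n) (t : term L m) :
  v =1 w -> rename v t = rename w t.
Proof. by move=> /functional_extensionality->. Qed.

Lemma eq_tsubst m n (v w : 'I_m -> term L n) (t : term L m) :
  v =1 w -> tsubst v t = tsubst w t.
Proof. by move=> /functional_extensionality->. Qed.

Lemma rename_tsubst m n p (s : 'I_m -> term L n) (v : 'I_n -> 'I_p) t :
  rename v (tsubst s t) = tsubst (fun i => rename v (s i)) t.
Proof. exact: tsubst_comp. Qed.

Lemma occ_rename m n (v : 'I_m -> 'I_n) (t : term L m) i :
  occ i (rename v t) = \sum_j occ j t * (v j == i).
Proof. exact: occ_tsubst. Qed.

Lemma linreg_rename m n (v : 'I_m -> 'I_n) (t : term L m) :
  linreg t -> bijective v -> linreg (rename v t).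
Proof.
move=> tl vb i; rewrite occ_rename -[RHS](bij_fibers1 i vb).
by apply: eq_bigr => j _; rewrite tl mul1n.
Qed.

Lemma linreg_App_Var m n (f : L m) (v : 'I_m -> 'I_n) :
  linreg (App f (fun i => Var (v i))) <-> bijective v.
Proof.
by split=> [|vb i /=]; [exact: fibers1_bij | exact: bij_fibers1].
Qed.

Lemma occ_provable (A : equations L) n (t s : term L n) :
  (forall n (t s : term L n), A n t s -> linreg t /\ linreg s) ->
  provable A t s -> forall i, occ i t = occ i s.
Proof.
move=> Al; elim=> {n t s} //=.
- by move=> n t s /Al[tl sl] i; rewrite tl sl.
- by move=> n t s r _ IH _ IH' i; rewrite IH.
- by move=> n k f ts ss _ IH i; apply: eq_bigr => j _; apply: IH.
- move=> m n t s u _ IH i; rewrite !occ_tsubst.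
  by apply: eq_bigr => j _; rewrite IH.
Qed.

(** The variables of the i-th term are moved to the i-th block, as on the left of [oe_comp]; on
    classes of terms this becomes the operadic composition. *)
Definition graft k (n : 'I_k -> nat) (fs : forall i, term L (n i)) (h : term L k) :
  term L (\sum_i n i) := tsubst (fun i => rename (tagnat.Rank i) (fs i)) h.

(** The two iterated substitutions differ only in the numbering of the variables, which [Rank_Rank]
    reconciles. *)
Lemma graftA k (n : 'I_k -> nat) (m : forall i, 'I_(n i) -> nat)
    (g : forall i j, term L (m i j)) (f : forall i, term L (n i)) (h : term L k)
    (e : \sum_i \sum_(j < n i) m i j =
         \sum_l m (tagnat.sig1 l) (tagnat.sig2 l)) :
  rename (cast_ord e) (graft (fun i => graft (g i) (f i)) h) =
  graft (fun l => g (tagnat.sig1 l) (tagnat.sig2 l)) (graft f h).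
Proof.
rewrite /graft rename_tsubst tsubst_comp; apply: eq_tsubst => i.
rewrite rename_rename rename_tsubst tsubst_rename; apply: eq_tsubst => j.
rewrite rename_rename -(sig_RankK (fun i j => rename (fun r => cast_ord e
  (tagnat.Rank (p_ := fun i => \sum_(j < n i) m i j) i
     (tagnat.Rank (p_ := m i) j r))) (g i j))).
by apply: eq_rename => r; apply: ord_inj; rewrite -Rank_Rank.
Qed.

Lemma graft_star k (n : 'I_k -> nat) (s : forall i, 'S_(n i)) (t : 'S_k)
    (f : forall i, term L (n i)) (h : term L k) :
  graft (fun i => rename (s i) (f i)) (rename t h) =
  rename (star s t) (rename (cast_ord (sum_perm n t)) (graft (fun i => f (t i)) h)).
Proof.
rewrite /graft tsubst_rename rename_rename rename_tsubst; apply: eq_tsubst => i.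
rewrite !rename_rename; apply: eq_rename => r; rewrite star_Rank.
by rewrite (sig_RankK (n := fun i => n (t i)) (fun i r => tagnat.Rank (t i) (s (t i) r))).
Qed.

Lemma linreg_graft k (n : 'I_k -> nat) (fs : forall i, term L (n i)) h :
  (forall i, linreg (fs i)) -> linreg h -> linreg (graft fs h).
Proof.
move=> fl hl l; rewrite occ_tsubst -[RHS](sum_eq_Rank l).
apply: eq_bigr => i _; rewrite hl mul1n occ_rename.
by apply: eq_bigr => r _; rewrite fl mul1n.
Qed.
End Renaming.

(** * Normal forms in the theory of an operad *)

Section TheoryOfOperad.
Variable O : sym_operad.
Notation E := (theory_of_operad O).

Lemma operad_eqns_linreg n (t s : term O n) :
  operad_eqns t s -> linreg t /\ linreg s.
Proof.
case=> {n t s} [|m k fs f|n s f]; split; try exact: linreg_gen_term.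
- by move=> i; rewrite (ord1 i).
- exact: (linreg_graft (fun i => linreg_gen_term (fs i)) (linreg_gen_term f)).
- exact/linreg_App_Var/injF_bij/perm_inj.
Qed.

Lemma occ_thm n (t s : term O n) i : thm_of E t s -> occ i t = occ i s.
Proof. by move=> ts; apply: occ_provable operad_eqns_linreg ts i. Qed.

Lemma theory_of_operad_linreg : linreg_theory E.
Proof.
move=> n t s; rewrite /thm_of; elim=> {n t s}.
- move=> n t s ts; have [tl sl] := operad_eqns_linreg ts.
  by apply: prv_hyp; split=> //; apply: prv_hyp.
- by move=> n t; apply: prv_refl.
- by move=> n t s _; apply: prv_sym.
- by move=> n t s r _ IH _; apply: prv_trans.
- by move=> n k f ts ss _; apply: prv_app.
- by move=> m n t s u _; apply: prv_subst.
Qed.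

Lemma normal_form n (t : term O n) :
  exists m (f : O m) (v : 'I_m -> 'I_n), thm_of E t (App f (fun i => Var (v i))).
Proof.
elim: t => [i|k f ts IH].
  exists 1, opunit, (fun=> i); apply: prv_sym.
  exact: (prv_subst (fun=> Var i) (prv_hyp (oe_unit O))).
have /fin_all_exists[m /fin_all_exists[g /fin_all_exists[v ts_nf]]] := IH.
exists _, (opcomp g f), (fun l => v (tagnat.sig1 l) (tagnat.sig2 l)).
apply: prv_trans (prv_app f ts_nf) _.
have := prv_subst (fun l => Var (v (tagnat.sig1 l) (tagnat.sig2 l)))
  (prv_hyp (oe_comp g f)); rewrite /=; congr provable; congr App.
apply: functional_extensionality => i; congr App.
by apply: functional_extensionality => r; rewrite (sig_RankK (fun i r => Var (v i r))).
Qed.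

Lemma linreg_normal_form n (t : term O n) :
  linreg t -> exists f : O n, thm_of E t (gen_term f).
Proof.
move=> tl; have [m [f [v tE]]] := normal_form t.
have vb : bijective v.
  by apply/(linreg_App_Var f) => i; rewrite -(occ_thm i tE).
have mn : m = n by rewrite -(card_ord m) -(card_ord n); apply: bij_eq_card vb.
case: n / mn t tl v tE vb => t tl v tE vb.
(* Now [v] is a permutation, and [oe_act] absorbs it into the operation. *)
exists (act (perm (bij_inj vb)) f); apply: prv_trans tE _.
have := prv_hyp (oe_act (perm (bij_inj vb)) f); congr provable; congr App.
by apply: functional_extensionality => i; rewrite permE.
Qed.
End TheoryOfOperad.

(** * Isomorphisms, linear-regular interpretations and operad morphisms *)

Section Interpretations.
Variables O O' : sym_operad.
Notation E := (theory_of_operad O).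
Notation E' := (theory_of_operad O').

Lemma iso_linreg (u : interp E E') (g : interp E' E) :
  interp_eqv (interp_comp g u) (interp_id E) ->
  interp_eqv (interp_comp u g) (interp_id E') -> linreg_interp u.
Proof.
move=> guE ugE n f i.
have [m [f' [v uE]]] := normal_form (u n f).
have [p [f2 [w gE]]] := normal_form (g m f').
(* Were j outside the image of [w], x_j would not occur in the image of [g m f'] under [u], which is
   provably f'(x_1, ..., x_m). *)
have w_surj j : exists l, w l == j.
  have := occ_thm j (ugE m f'); rewrite [RHS](linreg_gen_term f' j) /=.
  rewrite (occ_thm j (ext_interp_thm u gE)) /= occ_tsubst => w1.
  apply/existsP; apply: contraPT w1 => /existsPn w0.
  by rewrite big1 // => l _ /=; rewrite (negbTE (w0 l)) muln0.
have g_pos j : 0 < occ j (g m f').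
  by have [l wl] := w_surj j; rewrite (occ_thm j gE) /= (bigD1 l) //= wl.
have := occ_thm i (guE n f); rewrite [RHS](linreg_gen_term f i) /=.
rewrite (occ_thm i (ext_interp_thm g uE)) /= occ_tsubst /= => g1.
(* The fibre of [v] over i has at most one element because the weights in [g1] are positive, and at
   least one because an empty fibre would make that sum 0. *)
rewrite (occ_thm i uE) /=; apply/eqP; rewrite eqn_leq; apply/andP; split.
  rewrite -g1; apply: leq_sum => j _; exact: leq_pmull.
rewrite lt0n sum_nat_eq0; apply/negP => /forallP v0.
by move: g1; rewrite big1 // => j _; rewrite (eqP (v0 j)) muln0.
Qed.

(** Each law of a morphism comes from the image under [u] of the matching equation in [operad_eqns];
    [gen_term_inj] turns the provable equality into an equality of operations. *)
Lemma linreg_interp_hom (u : interp E E') :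
  linreg_interp u ->
  {h : operad_hom O O' | interp_eqv (interp_of_operad_hom h) u}.
Proof.
move=> ul; pose hP n (f : O n) := linreg_normal_form (ul n f).
pose h n (f : O n) := proj1_sig (constructive_indefinite_description _ (hP n f)).
have hE n (f : O n) : thm_of E' (u n f) (gen_term (h n f)).
  exact: proj2_sig (constructive_indefinite_description _ (hP n f)).
have h_unit : h 1 opunit = opunit.
  apply: gen_term_inj; apply: prv_trans (prv_sym (hE _ _)) _.
  have := isymb_eqns u (oe_unit O); rewrite /= tsubst_var => /prv_trans; apply.
  exact/prv_sym/prv_hyp/oe_unit.
have h_comp k (n : 'I_k -> nat) (f : forall i, O (n i)) (x : O k) :
    h _ (opcomp f x) = opcomp (fun i => h _ (f i)) (h _ x).
  apply: gen_term_inj; apply: prv_trans (prv_sym (hE _ _)) _.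
  have := isymb_eqns u (oe_comp f x); rewrite /= tsubst_var => /prv_sym/prv_trans; apply.
  apply: prv_trans (prv_subst _ (hE _ x)) _ => /=.
  apply: prv_trans (prv_hyp (oe_comp (fun i => h _ (f i)) (h _ x))).
  by apply: prv_app => i; apply: prv_subst (hE _ (f i)).
have h_act n (s : 'S_n) (f : O n) : h _ (act s f) = act s (h _ f).
  apply: gen_term_inj; apply: prv_trans (prv_sym (hE _ _)) _.
  have := isymb_eqns u (oe_act s f); rewrite /= tsubst_var => /prv_sym/prv_trans; apply.
  apply: prv_trans (prv_subst _ (hE _ f)) _ => /=.
  exact: (prv_hyp (oe_act s (h _ f))).
by exists (OperadHom h_unit h_comp h_act) => n f; apply/prv_sym/hE.
Qed.
End Interpretations.

(** * The operad of a theory *)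

Section OperadOfTheory.
Variable T : eq_theory.
Notation L := (symb T).

Lemma thm_rename m n (v : 'I_m -> 'I_n) (t s : term L m) :
  thm_of T t s -> thm_of T (rename v t) (rename v s).
Proof. exact: prv_subst. Qed.

Lemma thm_graft k (n : 'I_k -> nat) (fs gs : forall i, term L (n i)) (h h' : term L k) :
  (forall i, thm_of T (fs i) (gs i)) -> thm_of T h h' ->
  thm_of T (graft fs h) (graft gs h').
Proof.
move=> fg hh; apply: prv_trans (prv_subst _ hh) _.
by apply: prv_tsubst => i; apply: thm_rename; apply: fg.
Qed.

(** The quotient of linear-regular terms by provable equality: a class is the predicate of being
    provably equal to some linear-regular term. *)
Definition lrclass n :=
  {P : term L n -> Prop | exists t, linreg t /\ P = thm_of T t}.

Definition cls n (t : term L n) (tl : linreg t) : lrclass n :=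
  exist _ (thm_of T t) (ex_intro _ t (conj tl erefl)).

Definition repr n (q : lrclass n) : term L n :=
  proj1_sig (constructive_indefinite_description _ (proj2_sig q)).

Lemma repr_linreg n (q : lrclass n) : linreg (repr q).
Proof. by rewrite /repr; case: constructive_indefinite_description => t []. Qed.

Lemma lrclassE n (q : lrclass n) : proj1_sig q = thm_of T (repr q).
Proof. by rewrite /repr; case: constructive_indefinite_description => t []. Qed.

Lemma thm_repr n (t : term L n) (tl : linreg t) : thm_of T (repr (cls tl)) t.
Proof. by rewrite -lrclassE; apply: prv_refl. Qed.

(** Extensionality and proof irrelevance give a strict equality of classes, as the laws of
    [sym_operad] require. *)
Lemma eq_lrclass n (p q : lrclass n) : thm_of T (repr p) (repr q) -> p = q.
Proof.
move=> pq; have : proj1_sig p = proj1_sig q.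
  rewrite !lrclassE; apply: functional_extensionality => t.
  apply: propositional_extensionality.
  by split; apply: prv_trans => //; apply: prv_sym.
case: p q {pq} => [P Pc] [Q Qc] /= PQ; case: Q / PQ Qc => Qc.
by rewrite (proof_irrelevance _ Pc Qc).
Qed.

Lemma eq_Tagged_lrclass m n (p : lrclass m) (q : lrclass n) (e : m = n) :
  thm_of T (rename (cast_ord e) (repr p)) (repr q) ->
  Tagged lrclass p = Tagged lrclass q.
Proof.
case: n / e q => q; rewrite rename_id => [|i]; last exact: cast_ord_id.
by move/eq_lrclass->.
Qed.

Lemma repr_ecast m n (e : m = n) (p : lrclass m) :
  repr (ecast n (lrclass n) e p) = rename (cast_ord e) (repr p).
Proof. by case: n / e => /=; rewrite rename_id // => i; apply: cast_ord_id. Qed.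

Lemma linreg_Var : linreg (Var ord0 : term L 1).
Proof. by move=> i; rewrite (ord1 i). Qed.

Definition lrunit : lrclass 1 := cls linreg_Var.

Definition lrcomp k (n : 'I_k -> nat) (f : forall i, lrclass (n i)) (h : lrclass k) :
    lrclass (\sum_i n i) :=
  cls (linreg_graft (fun i => repr_linreg (f i)) (repr_linreg h)).

Definition lract n (s : 'S_n) (f : lrclass n) : lrclass n :=
  cls (linreg_rename (repr_linreg f) (injF_bij (@perm_inj _ s))).

Lemma repr_unit : thm_of T (repr lrunit) (Var ord0).
Proof. exact: thm_repr. Qed.

Lemma repr_comp k (n : 'I_k -> nat) (f : forall i, lrclass (n i)) (h : lrclass k) :
  thm_of T (repr (lrcomp f h)) (graft (fun i => repr (f i)) (repr h)).
Proof. exact: thm_repr. Qed.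

Lemma repr_act n (s : 'S_n) (f : lrclass n) :
  thm_of T (repr (lract s f)) (rename s (repr f)).
Proof. exact: thm_repr. Qed.

Lemma lrcompA k (n : 'I_k -> nat) (m : forall i, 'I_(n i) -> nat)
    (g : forall i j, lrclass (m i j)) (f : forall i, lrclass (n i)) (h : lrclass k) :
  Tagged lrclass (lrcomp (fun i => lrcomp (g i) (f i)) h) =
  Tagged lrclass (lrcomp (fun l => g (tagnat.sig1 l) (tagnat.sig2 l)) (lrcomp f h)).
Proof.
apply: (eq_Tagged_lrclass (e := esym (sum_sig m))).
apply: prv_trans (thm_rename _ (repr_comp _ _)) _.
apply: prv_trans (thm_rename _ (thm_graft (fun i => repr_comp _ _) (prv_refl _ _))) _.
rewrite (graftA (fun i j => repr (g i j))); apply: prv_sym.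
apply: prv_trans (repr_comp _ _) _.
by apply: thm_graft (repr_comp _ _) => l; apply: prv_refl.
Qed.

Lemma lrcomp1l k (f : lrclass k) :
  Tagged lrclass (lrcomp (fun _ : 'I_k => lrunit) f) = Tagged lrclass f.
Proof.
have e : \sum_(i < k) 1 = k by rewrite sum1_card card_ord.
apply: (eq_Tagged_lrclass (e := e)).
apply: prv_trans (thm_rename _ (repr_comp _ _)) _.
apply: prv_trans (thm_rename _ (thm_graft (fun i => repr_unit) (prv_refl _ _))) _.
rewrite rename_tsubst [tsubst _ _]rename_id => [|i]; first exact: prv_refl.
by apply: ord_inj; rewrite [LHS]Rank_ones.
Qed.

Lemma lrcomp1r m (f : lrclass m) :
  Tagged lrclass (lrcomp (fun _ : 'I_1 => f) lrunit) = Tagged lrclass f.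
Proof.
have e : \sum_(i < 1) m = m by rewrite big_ord1.
apply: (eq_Tagged_lrclass (e := e)).
apply: prv_trans (thm_rename _ (repr_comp _ _)) _.
apply: prv_trans (thm_rename _ (thm_graft (fun i => prv_refl _ _) repr_unit)) _.
rewrite /graft /= rename_rename rename_id => [|i]; first exact: prv_refl.
by apply: ord_inj; rewrite [LHS]tagnat.RankEsum big_pred0.
Qed.

Lemma lract1 n (f : lrclass n) : lract 1%g f = f.
Proof.
apply: eq_lrclass; apply: prv_trans (repr_act _ _) _.
by rewrite rename_id => [|i]; [exact: prv_refl | exact: perm1].
Qed.

Lemma lractM n (s t : 'S_n) (f : lrclass n) : lract (t * s)%g f = lract s (lract t f).
Proof.
apply: eq_lrclass; apply: prv_trans (repr_act _ _) _; apply: prv_sym.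
apply: prv_trans (repr_act _ _) _; apply: prv_trans (thm_rename _ (repr_act _ _)) _.
rewrite rename_rename (@eq_rename _ _ _ _ (t * s)%g) => [|i]; last by rewrite permM.
exact: prv_refl.
Qed.

Lemma lrcomp_act k (n : 'I_k -> nat) (s : forall i, 'S_(n i)) (t : 'S_k)
    (f : forall i, lrclass (n i)) (h : lrclass k) :
  lrcomp (fun i => lract (s i) (f i)) (lract t h) =
  lract (star s t)
    (ecast m (lrclass m) (sum_perm n t) (lrcomp (fun i => f (t i)) h)).
Proof.
apply: eq_lrclass; apply: prv_trans (repr_comp _ _) _.
apply: prv_trans (thm_graft (fun i => repr_act _ _) (repr_act _ _)) _.
rewrite graft_star; apply: prv_sym; apply: prv_trans (repr_act _ _) _.
by rewrite repr_ecast; do 2 apply: thm_rename; apply: repr_comp.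
Qed.

Definition operad_of_theory : sym_operad :=
  SymOperad lrcompA lrcomp1l lrcomp1r lract1 lractM lrcomp_act.

Notation E := (theory_of_operad operad_of_theory).

Definition counit : interp E T.
Proof.
refine (@Interp E T repr _) => n t s; case=> {n t s} [|m k fs f|n s f] /=.
- rewrite tsubst_var; exact: repr_unit.
- rewrite tsubst_var; apply: prv_sym; exact: repr_comp.
- rewrite tsubst_var; apply: prv_sym; exact: repr_act.
Defined.

Lemma counit_linreg : linreg_interp counit.
Proof. by move=> n f; apply: repr_linreg. Qed.

Definition counit_inv n (f : L n) : term operad_of_theory n :=
  gen_term (cls (linreg_gen_term f) : operad_of_theory n).

(** As [E] is the theory of an operad, the interpretation of t has a normal form
    q(x_1, ..., x_n), and applying [counit] identifies q as the class of t. *)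
Lemma counit_inv_linreg n (t : term L n) (tl : linreg t) :
  thm_of E (ext_interp counit_inv t) (gen_term (cls tl : operad_of_theory n)).
Proof.
(* Not knowing yet that [counit_inv] respects the equations of T, we use the
   theory [T0] with the symbols of T and no equations. *)
pose T0 := EqTheory (fun n (_ _ : term L n) => False).
have J0 : forall n (t s : term L n), @eqns T0 n t s ->
  thm_of E (ext_interp counit_inv t) (ext_interp counit_inv s) by [].
have I0 : forall n (t s : term L n), @eqns T0 n t s ->
  thm_of T (ext_interp (@gen_term L) t) (ext_interp (@gen_term L) s) by [].
pose J := @Interp T0 E _ J0; pose I := @Interp T0 T _ I0.
have JI : interp_eqv (interp_comp counit J) I.
  by move=> m f; rewrite /= tsubst_var; apply: thm_repr.
have Jl : linreg (ext_interp J t).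
  by move=> i; rewrite occ_ext_interp // => m f; apply: linreg_gen_term.
have [q tq] := linreg_normal_form Jl; apply: (prv_trans tq).
rewrite (_ : q = cls tl); first exact: prv_refl.
apply: eq_lrclass; apply: prv_trans (prv_sym (thm_repr tl)).
have := ext_interp_thm counit tq; rewrite /= tsubst_var => /prv_sym/prv_trans; apply.
have := @ext_interp_eqv T0 T _ _ n t JI; rewrite ext_interp_id.
by rewrite (ext_interp_comp J counit).
Qed.

(** Provably equal linear-regular terms have the same class, so by [counit_inv_linreg] the
    linear-regular consequences of [T] are respected. As [T] is linear-regular, they axiomatize all
    its consequences. *)
Lemma counit_inv_thm (T_linreg : linreg_theory T) n (t s : term L n) :
  thm_of T t s -> thm_of E (ext_interp counit_inv t) (ext_interp counit_inv s).
Proof.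
have J1 m (x y : term L m) : linreg_thms x y ->
    thm_of E (ext_interp counit_inv x) (ext_interp counit_inv y).
  case=> xy xl yl; apply: prv_trans (counit_inv_linreg xl) _.
  rewrite (_ : cls xl = cls yl); first exact/prv_sym/counit_inv_linreg.
  apply: eq_lrclass; apply: prv_trans (thm_repr xl) _.
  exact: prv_trans xy (prv_sym (thm_repr yl)).
move=> /T_linreg; exact: (ext_interp_thm (@Interp (EqTheory (@linreg_thms T)) E _ J1)).
Qed.
End OperadOfTheory.

(** * The equivalence *)

Section FullyFaithful.
Local Open Scope cat_scope.

#[local] Instance eqv_Equivalence (C : category) (a b : C) :
  Equivalence (@eqv C a b) := eqv_equiv a b.

#[local] Instance compc_Proper (C : category) (a b c : C) :
  Proper (eqv ==> eqv ==> eqv) (@compc C a b c).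
Proof. by move=> g g' eg f f' ef; apply: compc_eqv. Qed.

Variables (C D : category) (F : functor C D).
Hypothesis F_faithful : faithful F.
Hypothesis F_full : forall (a b : C) (u : hom (F a) (F b)), exists h, fmap F h ~= u.
Hypothesis F_surj : forall d : D, exists (c : C) (e : hom (F c) d), is_iso e.

(** Choice provides [G d], an isomorphism [eps d] from its image to [d], and lifts along [F]. The
    inverse functor lifts the conjugate of an arrow by [eps]; its laws and naturality are checked
    after applying [F], which is faithful. *)
Lemma fully_faithful_is_equivalence : is_equivalence F.
Proof.
have /(_ _)/constructive_indefinite_description-/all_sig[G /(_ _)
  /constructive_indefinite_description-/all_sig[eps /(_ _)
  /constructive_indefinite_description-/all_sig[inv inv_eps]]] := F_surj.
pose lift a b (u : hom (F a) (F b)) : hom a b :=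
  proj1_sig (constructive_indefinite_description _ (F_full u)).
have liftE a b (u : hom (F a) (F b)) : fmap F (lift a b u) ~= u.
  exact: proj2_sig (constructive_indefinite_description _ (F_full u)).
have eps_invA d c (x : hom c d) : eps d \oc (inv d \oc x) ~= x.
  rewrite compcA (inv_eps d).2 comp1c; reflexivity.
pose Gmap d d' (u : hom d d') := lift _ _ (inv d' \oc (u \oc eps d)).
have Gmap_eqv d d' (u v : hom d d') : u ~= v -> Gmap _ _ u ~= Gmap _ _ v.
  by move=> uv; apply: F_faithful; rewrite !liftE uv; reflexivity.
have Gmap_id d : Gmap _ _ (idc d) ~= idc (G d).
  by apply: F_faithful; rewrite liftE fmap_id comp1c (inv_eps d).1; reflexivity.
have Gmap_comp d1 d2 d3 (g : hom d2 d3) (f : hom d1 d2) :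
    Gmap _ _ (g \oc f) ~= Gmap _ _ g \oc Gmap _ _ f.
  apply: F_faithful; rewrite fmap_comp !liftE -!compcA eps_invA; reflexivity.
exists (Functor Gmap_eqv Gmap_id Gmap_comp); split.
  exists (fun a => lift _ _ (eps (F a))); split=> [a|a b f].
    exists (lift _ _ (inv (F a))); split; apply: F_faithful.
      by rewrite fmap_comp !liftE fmap_id (inv_eps _).1; reflexivity.
    by rewrite fmap_comp !liftE fmap_id (inv_eps _).2; reflexivity.
  apply: F_faithful; rewrite /= !fmap_comp !liftE eps_invA; reflexivity.
exists eps; split=> [d|d d' u]; first by exists (inv d); apply: inv_eps.
by rewrite /= liftE eps_invA; reflexivity.
Qed.
End FullyFaithful.

(** * The factorization through [LrET] *)

Lemma linreg_interp_of_operad_hom (O O' : sym_operad) (h : operad_hom O O') :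
  linreg_interp (interp_of_operad_hom h).
Proof. by move=> n f; apply: linreg_gen_term. Qed.

Definition Pa_lr : functor SOp LrET.
Proof.
refine (@Functor SOp LrET
  (fun O => exist linreg_theory _ (@theory_of_operad_linreg O))
  (fun O O' h => exist (@linreg_interp _ _) _ (linreg_interp_of_operad_hom h)) _ _ _).
- exact: (fmap_eqv Pa_oe).
- exact: (fmap_id Pa_oe).
- exact: (fmap_comp Pa_oe).
Defined.

Lemma Pa_oe_faithful : faithful Pa_oe.
Proof. by move=> O O' h h' e n f; apply/gen_term_inj/e. Qed.

(** By [iso_linreg], both [u] and its inverse are linear-regular, so both come from morphisms;
    faithfulness shows these to be mutually inverse. *)
Lemma Pa_oe_full_on_isos : full_on_isos Pa_oe.
Proof.
move=> O O' u [g [guE ugE]].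
have [h hu] := linreg_interp_hom (iso_linreg guE ugE).
have [h' hg] := linreg_interp_hom (iso_linreg ugE guE).
exists h; split=> //; exists h'; split; apply: Pa_oe_faithful.
- apply: eqv_trans (fmap_comp Pa_oe _ _) _; apply: eqv_trans guE.
  exact: (compc_eqv (c := _)).
- apply: eqv_trans (fmap_comp Pa_oe _ _) _; apply: eqv_trans ugE.
  exact: (compc_eqv (c := _)).
Qed.

Lemma Pa_lr_equivalence : is_equivalence Pa_lr.
Proof.
apply: fully_faithful_is_equivalence.
- exact: Pa_oe_faithful.
- by move=> O O' [u ul]; have [h hu] := linreg_interp_hom ul; exists h.
(* Essential surjectivity: the isomorphism onto [T] is [counit], and its inverse sends a symbol to
   the class of its generic term. *)
move=> [T T_linreg]; exists (operad_of_theory T : SOp).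
exists (exist (@linreg_interp _ _) _ (@counit_linreg T)).
pose J : interp T (theory_of_operad (operad_of_theory T)) :=
  Interp (fun n t s ts => counit_inv_thm T_linreg (prv_hyp ts)).
have J_linreg : linreg_interp J by move=> n f; apply: linreg_gen_term.
exists (exist (@linreg_interp _ _) J J_linreg); split.
- move=> n q /=; apply: prv_trans (counit_inv_linreg (repr_linreg q)) _.
  rewrite (_ : cls _ = q); first exact: prv_refl.
  by apply: eq_lrclass; apply: thm_repr.
- by move=> n f /=; rewrite tsubst_var; apply: thm_repr.
Qed.

Theorem proposition6p2 :
  faithful Pa_oe /\
  full_on_isos Pa_oe /\
  (exists E_o : functor SOp LrET,
     is_equivalence E_o /\ functor_eq (comp_functor LrET_incl E_o) Pa_oe).
Proof.
split; first exact: Pa_oe_faithful.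
split; first exact: Pa_oe_full_on_isos.
exists Pa_lr; split; first exact: Pa_lr_equivalence.
(* Both functors are convertible on objects, so [HEqv] applies without any transport. *)
by move=> O O' h; apply: HEqv; apply: eqv_refl.
Qed.
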